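(* Let $G$ be a connected graph with $n$ nodes. The graph cubeahedron $\mathcal{C}G$ is a simple convex polytope of dimension $n$ whose face poset is isomorphic to the set of design tubings of $G$, ordered such that $U\prec U'$ if $U$ is obtained from $U'$ by adding tubes.
   Context: Let $G$ be a (finite) connected graph. A round tube is a nonempty set of nodes of $G$ whose induced graph is a connected (not necessarily proper) subgraph of $G$. A square tube is a single node of $G$. Round and square tubes are called design tubes (a single node $v$ thus gives two different design tubes, a round one and a square one). Two tubes $u_1,u_2$ (as node sets) are nested if one is contained in the other (equality of node sets included); they intersect if $u_1\cap u_2\ne\emptyset$, $u_1\not\subset u_2$ and $u_2\not\subset u_1$; they are adjacent if $u_1\cap u_2=\emptyset$ and $u_1\cup u_2$ induces a connected subgraph of $G$. Two distinct design tubes are compatible if: when both are round, they are not adjacent and do not intersect; otherwise (at least one is square), they are not nested. A design tubing of $G$ is a set (possibly empty) of pairwise compatible design tubes of $G$. For a graph $G$ with $n$ nodes, $\square_G$ is the $n$-cube in which each pair of opposite facets corresponds to a node of $G$, one facet of the pair representing that node as a round tube and the other representing it as a square tube. Each subset of nodes of $G$, each chosen to be either round or square, corresponds to the face of $\square_G$ that is the intersection of the facets associated to those nodes (the empty set corresponds to $\square_G$ itself). The graph cubeahedron $\mathcal{C}G$ is the polytope obtained from $\square_G$ by truncating the faces which correspond to round tubes (all nodes of the tube chosen round), in increasing order of dimension. The face poset is the poset of nonempty faces ordered by inclusion. *)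

(* Defs.v *)
From mathcomp Require Export all_boot all_order all_algebra.
From mathcomp Require Export boolp classical_sets functions cardinality reals.

Set Implicit Arguments.
Unset Strict Implicit.
Unset Printing Implicit Defensive.

Import Order.TTheory GRing.Theory Num.Theory.

Local Open Scope ring_scope.
Local Open Scope classical_set_scope.
Local Open Scope card_scope.

Section Tubings.
Variables (T : finType) (e : rel T).

(* The graph induced by [e] on [A] is connected.  This holds for [A] empty,
   hence the nonemptiness requirement in [round_tube]. *)
Definition connected_in (A : {set T}) : bool :=
  [forall x in A, forall y in A,
     connect [rel a b | [&& a \in A, b \in A & e a b]] x y].

Definition round_tube (A : {set T}) : bool := (A != finset.set0) && connected_in A.

(* [inl A] is [A] taken as a round tube, [inr v] is [v] taken as a square tube. *)
Definition tube : finType := ({set T} + T)%type.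

Definition design_tube (u : tube) : bool :=
  if u is inl A then round_tube A else true.

Definition is_round (u : tube) : bool := if u is inl _ then true else false.

Definition nodes (u : tube) : {set T} :=
  match u with inl A => A | inr v => [set v]%SET end.

Definition nested (A B : {set T}) : bool := (A \subset B) || (B \subset A).

Definition intersecting (A B : {set T}) : bool :=
  [&& A :&: B != finset.set0, ~~ (A \subset B) & ~~ (B \subset A)].

Definition adjacent (A B : {set T}) : bool :=
  (A :&: B == finset.set0) && connected_in (A :|: B).

Definition compatible (u w : tube) : bool :=
  if is_round u && is_round w
  then ~~ adjacent (nodes u) (nodes w) && ~~ intersecting (nodes u) (nodes w)
  else ~~ nested (nodes u) (nodes w).

Definition design_tubing (U : {set tube}) : bool :=
  [forall u in U, design_tube u] &&
  [forall u in U, forall w in U, (u != w) ==> compatible u w].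

End Tubings.

Section Polytopes.
Variables (R : realType) (n : nat).
Implicit Types (P F Q : set 'rV[R]_n) (c x v : 'rV[R]_n) (b : R).

Definition dot c x : R := \sum_i c 0 i * x 0 i.

Definition convex_hull m (p : 'I_m -> 'rV[R]_n) : set 'rV[R]_n :=
  [set x | exists w : 'I_m -> R,
     [/\ forall i, 0 <= w i, \sum_i w i = 1 & x = \sum_i w i *: p i]].

Definition convex_polytope P : Prop :=
  exists m (p : 'I_m -> 'rV[R]_n), P = convex_hull p.

(* Dimension of the affine hull: one less than the largest number of affinely
   independent points [x, y_0, ..., y_(k-1)] of [P].  The empty set gets 0, so
   this is only meaningful on nonempty sets. *)
Definition aff_dim P : nat :=
  \max_(k < n.+1 | `[< exists x (y : 'I_k -> 'rV[R]_n),
      [/\ P x, forall i, P (y i) & row_free (\matrix_i (y i - x))] >]) k.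

(* Taking [c = 0] and [b = 0] shows that [P] is a face of itself. *)
Definition nonempty_face P F : Prop :=
  F !=set0 /\
  exists c b, (forall x, P x -> dot c x <= b) /\ F = P `&` [set x | dot c x = b].

Definition vertex P v : Prop := nonempty_face P [set v].

Definition facet P F : Prop := nonempty_face P F /\ (aff_dim F).+1 = aff_dim P.

Definition simple P : Prop :=
  forall v, vertex P v -> [set F | facet P F /\ F v] #= `I_(aff_dim P).

(* The face [F] of [P] is cut off by a hyperplane that strictly separates the
   vertices of [F] from the other vertices of [P]. *)
Definition truncation P F Q : Prop :=
  nonempty_face P F /\
  exists c b,
    [/\ forall v, vertex P v -> F v -> b < dot c v,
        forall v, vertex P v -> ~ F v -> dot c v < b
      & Q = P `&` [set x | dot c x <= b]].

(* When [F] is a face of the initial polytope, the face of a later polytope [P]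
   to which it corresponds is what the previous cuts left of it, [F `&` P]. *)
Fixpoint truncations P (Fs : seq (set 'rV[R]_n)) Q : Prop :=
  if Fs is F :: Fs' then
    exists P', truncation P (F `&` P) P' /\ truncations P' Fs' Q
  else Q = P.

End Polytopes.

Section Cubeahedron.
Variables (R : realType) (T : finType) (e : rel T).

Definition cube : set 'rV[R]_#|T| := [set x | forall i, 0 <= x 0 i <= 1].

(* The coordinate of the node [v] is [enum_rank v]; the facet where it is 0
   represents [v] as a round tube, the facet where it is 1 as a square tube. *)
Definition cube_facet (v : T) (square : bool) : set 'rV[R]_#|T| :=
  cube `&` [set x | x 0 (enum_rank v) = square%:R].

Definition cube_face (A : {set T}) (square : T -> bool) : set 'rV[R]_#|T| :=
  cube `&` \bigcap_(v in [set` A]) cube_facet v (square v).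

Definition round_face (A : {set T}) : set 'rV[R]_#|T| :=
  cube_face A (fun _ => false).

(* The order of truncation among faces of equal dimension and the cutting
   hyperplanes are not prescribed: this is the predicate "[P] is a realization
   of the graph cubeahedron". *)
Definition graph_cubeahedron (P : set 'rV[R]_#|T|) : Prop :=
  exists s : seq {set T},
    [/\ uniq s, s =i [pred A | round_tube e A],
        sorted (fun A B => aff_dim (round_face A) <= aff_dim (round_face B))%N s
      & truncations cube [seq round_face A | A <- s] P].

End Cubeahedron.

Definition order_isomorphic (X Y : Type) (A : set X) (leX : X -> X -> Prop)
    (B : set Y) (leY : Y -> Y -> Prop) : Prop :=
  exists f : X -> Y, set_bij A B f /\
    forall x x', A x -> A x' -> (leX x x' <-> leY (f x) (f x')).

(* Main.v *)
(* Keep a polytope [P = {x | a_i . x <= b_i}] nondegenerate: the normals of the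
   constraints active at a point are independent.  Then the nonempty faces of
   [P] are the sets [F_S] where a set [S] of constraints is tight, one for each
   [S] in the complex [K] of active sets, with inclusion reversed and
   [dim F_S = n - |S|].  Truncating [F_S0] preserves nondegeneracy and subdivides
   [K] stellarly, with the cut as new vertex.

   Iterating from the cube along a list [L] of tubes, a set of zero constraints
   [Z], square constraints [Q] and cuts [C] is in the complex iff [Q] avoids
   [Z] and the tubes of [C], and no tube [B] of [L] is covered by [Z] and the
   tubes of [C] that come after [B] in [L].  When [L] lists all tubes by
   decreasing size, singletons force [Z] to be empty.  If two tubes of [C] are
   adjacent or intersect, then both come after their union and cover it;
   conversely a connected [B] covered by compatible tubes lies in one of them. *)
Require Import Defs.
From mathcomp Require Import ring lra zify.
Import Order.TTheory GRing.Theory Num.Theory.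
Local Open Scope ring_scope.
Local Open Scope classical_set_scope.

Set Implicit Arguments.
Unset Strict Implicit.
Unset Printing Implicit Defensive.

(** * Linearity of the pairing [dot] *)

Section Dot.
Variables (R : realType) (n : nat).
Implicit Types (c x y d : 'rV[R]_n).

Lemma dotDr c x y : dot c (x + y) = dot c x + dot c y.
Proof. by rewrite /dot -big_split; apply: eq_bigr => i _; rewrite mxE mulrDr. Qed.

Lemma dotZr c (k : R) x : dot c (k *: x) = k * dot c x.
Proof. by rewrite /dot mulr_sumr; apply: eq_bigr => i _; rewrite mxE mulrCA. Qed.

Lemma dotNr c x : dot c (- x) = - dot c x.
Proof. by rewrite -scaleN1r dotZr mulN1r. Qed.

Lemma dotBr c x y : dot c (x - y) = dot c x - dot c y.
Proof. by rewrite dotDr dotNr. Qed.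

Lemma dot0l x : dot 0 x = 0.
Proof. by rewrite /dot big1 // => i _; rewrite mxE mul0r. Qed.

Lemma dot_suml (I : finType) (A : {set I}) (c : I -> 'rV[R]_n) x :
  dot (\sum_(i in A) c i) x = \sum_(i in A) dot (c i) x.
Proof.
rewrite /dot exchange_big; apply: eq_bigr => j _.
by rewrite summxE mulr_suml.
Qed.

Lemma dot_sumr c (I : finType) (w : I -> R) (x : I -> 'rV[R]_n) :
  dot c (\sum_i w i *: x i) = \sum_i w i * dot c (x i).
Proof.
rewrite /dot [LHS](eq_bigr (fun j => \sum_i w i * (c 0 j * x i 0 j))).
  by rewrite exchange_big; apply: eq_bigr => i _; rewrite mulr_sumr.
move=> j _; rewrite summxE mulr_sumr; apply: eq_bigr => i _.
by rewrite mxE mulrCA.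
Qed.

Lemma dot_deltal j x : dot (delta_mx 0 j) x = x 0 j.
Proof.
rewrite /dot (bigD1 j) //= big1 ?addr0 ?mxE ?eqxx ?mul1r // => i ij.
by rewrite mxE (negbTE ij) mul0r.
Qed.

Lemma dotNl c x : dot (- c) x = - dot c x.
Proof. by rewrite /dot -sumrN; apply: eq_bigr => i _; rewrite mxE mulNr. Qed.

End Dot.

Lemma finite_lower_bound (R : realType) (J : finType) (p : pred J) (g : J -> R) :
  (forall j, p j -> 0 < g j) -> exists2 m, 0 < m & forall j, p j -> m <= g j.
Proof.
(* The initial value 1 keeps the minimum positive when no index satisfies [p]. *)
move=> gp; exists (\big[Order.min/1]_(j | p j) g j); first exact: lt_bigmin.
by move=> j pj; apply: bigmin_le_cond.
Qed.

(** * Faces of a nondegenerate system of inequalities *)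

Section SimplePolyhedron.
Variables (R : realType) (n : nat) (I : finType) (a : I -> 'rV[R]_n) (b : I -> R).
Implicit Types (x y d v c : 'rV[R]_n) (S : {set I}).

Definition polyhedron : set 'rV[R]_n := [set x | forall i, dot (a i) x <= b i].

Definition active x : {set I} := [set i | dot (a i) x == b i]%SET.

Definition active_face S : set 'rV[R]_n :=
  [set x | polyhedron x /\ S \subset active x].

(* The first clause says that the recession cone is trivial, the second that
   the normals of the constraints active at a point are linearly independent. *)
Definition simple_system : Prop :=
  (forall d, d != 0 -> exists i, 0 < dot (a i) d) /\
  (forall x, polyhedron x -> forall f : I -> R, exists d,
      forall i, i \in active x -> dot (a i) d = f i).

Definition face_complex S : Prop := exists2 x, polyhedron x & active x = S.

Lemma activeP i x : reflect (dot (a i) x = b i) (i \in active x).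
Proof. by rewrite inE; apply: eqP. Qed.

Lemma active_slack x i : polyhedron x -> i \notin active x -> dot (a i) x < b i.
Proof. by move=> Px; rewrite inE lt_neqAle => ->; apply: Px. Qed.

Lemma polyhedron_conv x y (t : R) : 0 <= t <= 1 ->
  polyhedron x -> polyhedron y -> polyhedron ((1 - t) *: x + t *: y).
Proof.
move=> /andP[t0 t1] Px Py i; rewrite dotDr !dotZr.
have := Px i; have := Py i; nra.
Qed.

(** Slacks at the two ends cannot cancel when both weights are positive. *)
Lemma active_conv x y (t : R) : 0 < t < 1 -> polyhedron x -> polyhedron y ->
  active ((1 - t) *: x + t *: y) = active x :&: active y.
Proof.
move=> /andP[t0 t1] Px Py; apply/finset.setP => i; rewrite !inE dotDr !dotZr.
apply/eqP/andP => [h|[/eqP-> /eqP->]]; last by ring.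
have := Px i; have := Py i => yi xi; split; apply/eqP; nra.
Qed.

Lemma active_face_conv S x y (t : R) : 0 <= t <= 1 ->
  active_face S x -> active_face S y -> active_face S ((1 - t) *: x + t *: y).
Proof.
move=> t01 [Px Sx] [Py Sy]; split; first exact: polyhedron_conv.
apply/fintype.subsetP => i iS; apply/activeP; rewrite dotDr !dotZr.
rewrite (activeP _ _ (fintype.subsetP Sx i iS)) (activeP _ _ (fintype.subsetP Sy i iS)); ring.
Qed.

(** A short enough step preserves the constraints that are slack at [x], and those active at [x]
    stay tight or loosen according to their slope. One length serves all the directions [d j]. *)
Lemma small_step x (J : finType) (d : J -> 'rV[R]_n) : polyhedron x ->
  (forall j i, i \in active x -> dot (a i) (d j) <= 0) ->
  exists2 m : R, 0 < m & forall j, polyhedron (x + m *: d j) /\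
    active (x + m *: d j) = [set i in active x | dot (a i) (d j) == 0]%SET.
Proof.
move=> Px dle.
(* Adding 1 to the absolute slope makes the divisor positive and the resulting bound strict. *)
have [m m0 mP] := @finite_lower_bound R (I * J)%type
  (fun p => p.1 \notin active x)
  (fun p => (b p.1 - dot (a p.1) x) / (`|dot (a p.1) (d p.2)| + 1))
  (fun p h => divr_gt0 (etrans (subr_gt0 _ _) (active_slack Px h))
                (ltr_wpDl (normr_ge0 _) ltr01)).
exists m => // j.
have slack i : i \notin active x -> dot (a i) x + m * dot (a i) (d j) < b i.
  move=> ix; have := mP (i, j) ix; rewrite /= ler_pdivlMr ?ltr_wpDl ?normr_ge0 //.
  have := ler_norm (dot (a i) (d j)); nra.
split=> [i|]; first last.
  apply/finset.setP => i; rewrite !inE dotDr dotZr.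
  have [/activeP ix|ix] := boolP (i \in active x).
    by rewrite ix eqxx -subr_eq0 addrAC subrr add0r mulf_eq0 (gt_eqF m0).
  by rewrite (lt_eqF (slack i ix)) (lt_eqF (active_slack Px ix)).
rewrite dotDr dotZr; have [ix|/slack/ltW//] := boolP (i \in active x).
have := Px i; have := dle j i ix; nra.
Qed.

Hypothesis wf : simple_system.

(** Independence of the active normals gives a direction that keeps [S] tight and loosens every
    other active constraint; a small step along it does the rest. *)
Lemma face_complex_sub S S' : S \subset S' -> face_complex S' -> face_complex S.
Proof.
move=> SS' [x Px xS].
have [d dP] := wf.2 x Px (fun i => if i \in S then 0 else -1).
have [j i ix|m m0 /(_ tt)[Py yS]] := @small_step x unit (fun=> d) Px.
  by rewrite dP //; case: ifP => // _; lra.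
exists (x + m *: d) => //; rewrite yS xS; apply/finset.setP => i; rewrite inE.
have [iS'|iS'] := boolP (i \in S').
  by rewrite dP ?xS //; case: ifP; rewrite ?eqxx // oppr_eq0 oner_eq0.
by apply/esym/negbTE; apply: contra iS' => /(fintype.subsetP SS').
Qed.

Lemma active_face_nonempty S : active_face S !=set0 <-> face_complex S.
Proof.
split=> [[x [Px Sx]]|[x Px xS]]; last by exists x; split; rewrite ?xS.
by apply: (face_complex_sub Sx); exists x.
Qed.

Lemma active_face_subset S S' : face_complex S ->
  active_face S `<=` active_face S' <-> S' \subset S.
Proof.
move=> [x Px xS]; split=> [/(_ x) h|S'S y [Py Sy]].
  by rewrite -xS; apply: (h _).2; split=> //; rewrite xS.
by split=> //; apply: fintype.subset_trans S'S Sy.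
Qed.

Lemma active_face_inj S S' : face_complex S -> face_complex S' ->
  active_face S = active_face S' -> S = S'.
Proof.
move=> KS KS' E; apply/eqP; rewrite finset.eqEsubset.
by apply/andP; split; apply/active_face_subset => //; rewrite E.
Qed.

Lemma active_face_is_face S : face_complex S ->
  nonempty_face polyhedron (active_face S).
Proof.
move=> KS; split; first exact/active_face_nonempty.
(* A sum of valid inequalities is tight only where each of them is. *)
exists (\sum_(i in S) a i), (\sum_(i in S) b i); split=> [x Px|].
  by rewrite dot_suml; apply: ler_sum => i _; apply: Px.
apply/seteqP; split=> x /= [Px xS]; split=> //.
  by rewrite dot_suml; apply: eq_bigr => i /(fintype.subsetP xS)/activeP.
apply/fintype.subsetP => i iS; rewrite inE; apply: contraT => ni.
suff: dot (\sum_(i in S) a i) x < \sum_(i in S) b i by rewrite xS ltxx.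
rewrite dot_suml (bigD1 i) //= [ltRHS](bigD1 i) //=; apply: ltr_leD.
  by apply: active_slack; rewrite // inE.
by apply: ler_sum => j _; apply: Px.
Qed.

(* A point of [F] with as few active constraints as possible lies in the
   relative interior of [F]; extending segments beyond it shows [F] to be the
   whole face given by its active constraints. *)
Lemma nonempty_faceP F : nonempty_face polyhedron F <->
  exists2 S, face_complex S & F = active_face S.
Proof.
split=> [[[x0 Fx0] [c [be [cP FE]]]]|[S KS ->]]; last exact: active_face_is_face.
subst F; set F := _ `&` _ in Fx0 *.
pose q (k : nat) := `[< exists2 x, F x & #|active x| = k >].
have ex : exists k, q k by exists #|active x0|; apply/asboolP; exists x0.
case: (ex_minnP ex) => k /asboolP[x [Px /= cx] xk] kmin.
exists (active x); first by exists x.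
apply/seteqP; split=> y.
  move=> [Py /= cy]; split=> //.
  have h : 0 < (1 / 2 : R) < 1 by lra.
  pose z := (1 - 1 / 2) *: x + (1 / 2) *: y.
  have zE : active z = active x :&: active y by apply: active_conv.
  have Fz : F z.
    split; first by apply: polyhedron_conv => //; lra.
    by rewrite /= /z dotDr !dotZr cx cy; lra.
  have zmin : (#|active x| <= #|active z|)%N.
    by rewrite xk; apply: kmin; apply/asboolP; exists z.
  have zx : active z \subset active x by rewrite zE finset.subsetIl.
  have /eqP xz : active z == active x by rewrite eqEcard zx.
  by rewrite -xz zE finset.subsetIr.
move=> [Py xy].
have [j i ix|m m0 /(_ tt)[Pz _]] := @small_step x unit (fun=> x - y) Px.
  rewrite dotBr (activeP _ _ ix) (activeP _ _ (fintype.subsetP xy _ ix)); lra.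
split=> //=; apply/eqP.
rewrite eq_le cP //=; have := cP _ Pz; rewrite dotDr dotZr dotBr cx; nra.
Qed.

End SimplePolyhedron.

(** * Dimension, vertices and facets *)

Section Dimension.
Variables (R : realType) (n : nat) (I : finType) (a : I -> 'rV[R]_n) (b : I -> R).
Hypothesis wf : simple_system a b.
Implicit Types (x y d v c : 'rV[R]_n) (S : {set I}).

Let P := polyhedron a b.
Let act := active a b.

Definition normals S : 'M[R]_(#|S|, n) := \matrix_k a (enum_val k).

Lemma mulmx_normals m S (D : 'M[R]_(m, n)) k j :
  (D *m (normals S)^T) k j = dot (a (enum_val j)) (row k D).
Proof. by rewrite mxE; apply: eq_bigr => i _; rewrite !mxE mulrC. Qed.

(** Directions dual to the active normals, supplied by [simple_system], form a right inverse of the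
    matrix. *)
Lemma normals_free x : P x -> row_free (normals (act x)).
Proof.
move=> Px; apply/row_freeP.
have /choice[d dP] (k : 'I_#|act x|) : exists d, forall i, i \in act x ->
    dot (a i) d = (i == enum_val k)%:R by apply: wf.2.
exists (\matrix_k d k)^T; apply: trmx_inj; rewrite trmx_mul trmxK trmx1.
apply/matrixP => k j; rewrite mulmx_normals rowK dP ?enum_valP // mxE.
by rewrite (inj_eq enum_val_inj) eq_sym.
Qed.

Lemma card_active_le x : P x -> (#|act x| <= n)%N.
Proof. by move/normals_free/eqP <-; apply: rank_leq_col. Qed.

Definition active_kernel S : 'M[R]_n := kermx (normals S)^T.

Lemma rank_active_kernel x : P x -> \rank (active_kernel (act x)) = (n - #|act x|)%N.
Proof. by move=> Px; rewrite mxrank_ker mxrank_tr (eqP (normals_free Px)). Qed.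

Lemma sub_active_kernelP m S (D : 'M[R]_(m, n)) :
  reflect (forall k i, i \in S -> dot (a i) (row k D) = 0)
    (D <= active_kernel S)%MS.
Proof.
apply: (iffP sub_kermxP) => [D0 k i iS|D0].
  have := mulmx_normals D k (enum_rank_in iS i).
  by rewrite D0 mxE enum_rankK_in.
by apply/matrixP => k j; rewrite mulmx_normals D0 ?enum_valP // mxE.
Qed.

Lemma card_active_full x d : P x -> #|act x| = n ->
  (forall i, i \in act x -> dot (a i) d = 0) -> d = 0.
Proof.
move=> Px xn d0; have := rank_active_kernel Px.
rewrite xn subnn => /eqP; rewrite mxrank_eq0 => /eqP ker0.
apply/eqP; rewrite -submx0 -ker0; apply/sub_active_kernelP => k i ix.
by rewrite [k]ord1 row_id d0.
Qed.

Lemma active_kernel_dir x : P x -> (#|act x| < n)%N ->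
  exists2 d, d != 0 & forall i, i \in act x -> dot (a i) d = 0.
Proof.
move=> Px xn.
have /rowV0Pn[d dK d0] : active_kernel (act x) != 0.
  by rewrite -mxrank_eq0 rank_active_kernel // -lt0n subn_gt0.
exists d => // i ix; have /sub_active_kernelP/(_ 0 i ix) := dK.
by rewrite row_id.
Qed.

(** Differences of points of the face are killed by the normals in [S], which bounds the dimension
    above. Small steps along a basis of that kernel, from a point with active set exactly [S],
    attain the bound. *)
Lemma aff_dim_active_face S : face_complex a b S ->
  aff_dim (active_face a b S) = (n - #|S|)%N.
Proof.
move=> [x Px xS]; apply/eqP; rewrite eqn_leq; apply/andP; split.
  apply/bigmax_leqP => k /asboolP[x' [y [[_ Sx'] Fy yfree]]].
  have := rank_active_kernel Px; rewrite /act xS => <-.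
  rewrite -(eqP yfree); apply: mxrankS; apply/sub_active_kernelP => j i iS.
  have [_ Sy] := Fy j; rewrite rowK dotBr.
  by rewrite (activeP _ _ _ _ (fintype.subsetP Sy i iS))
             (activeP _ _ _ _ (fintype.subsetP Sx' i iS)) subrr.
set K := active_kernel S; have rK : \rank K = (n - #|S|)%N.
  by have := rank_active_kernel Px; rewrite /act xS.
have lt_n : (\rank K < n.+1)%N by rewrite ltnS rank_leq_col.
rewrite -rK -[leqLHS]/(nat_of_ord (Ordinal lt_n)); apply: leq_bigmax_cond.
have D0 k i : i \in S -> dot (a i) (row k (row_base K)) = 0.
  by move: k i; apply/sub_active_kernelP; rewrite eq_row_base.
have [k i ix|m m0 yP] :=
    @small_step _ _ _ a b x _ (fun k => row k (row_base K)) Px.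
  by rewrite D0 // -xS.
apply/asboolP; exists x, (fun k => x + m *: row k (row_base K)).
split; first by split; rewrite // xS.
  move=> k; have [Py yE] := yP k; split=> //; rewrite yE xS.
  by apply/fintype.subsetP => i iS; rewrite inE iS D0 ?eqxx.
have -> : \matrix_k (x + m *: row k (row_base K) - x) = m *: row_base K.
  by apply/row_matrixP => k; rewrite rowK addrAC subrr add0r linearZ.
by rewrite /row_free mxrank_scale_nz ?eq_row_base // gt_eqF.
Qed.

(** With fewer than [n] active constraints, [P] contains a segment with [v] in its interior, and a
    functional maximal at [v] is constant on it. Conversely, [n] independent tight constraints
    determine the point. *)
Lemma vertexP v : vertex P v <-> P v /\ #|act v| = n.
Proof.
split=> [[_ [c [be [cP vE]]]]|[Pv vn]].
  have [Pv cv] : (P `&` [set x | dot c x = be]) v by rewrite -vE.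
  split=> //; apply/eqP; rewrite eqn_leq card_active_le // leqNgt.
  apply/negP => /active_kernel_dir [] // d d0 dP.
  have [j i ix|m m0 yP] := @small_step _ _ _ a b v _
      (fun s : bool => if s then d else - d) Pv.
    by case: j; rewrite ?dotNr dP ?oppr0.
  have [[P1 _] [P2 _]] := (yP true, yP false).
  have [c1 c2] := (cP _ P1, cP _ P2).
  have : (P `&` [set x | dot c x = be]) (v + m *: d).
    split=> //=; apply/eqP; rewrite eq_le c1 /=.
    by move: c1 c2 (cv : dot c v = be); rewrite !dotDr !dotZr dotNr; lra.
  rewrite -vE => /eqP; rewrite -subr_eq0 addrAC subrr add0r scaler_eq0.
  by rewrite (gt_eqF m0) (negbTE d0).
suff E : [set v] = active_face a b (act v).
  by rewrite /vertex E; apply: active_face_is_face => //; exists v.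
apply/seteqP; split=> [x ->|x [Px vx]] /=; first by split.
apply/eqP; rewrite -subr_eq0; apply/eqP.
apply: (card_active_full Pv vn) => i iv.
by rewrite dotBr (activeP _ _ _ _ iv) (activeP _ _ _ _ (fintype.subsetP vx i iv)) subrr.
Qed.

(** Some constraint increases along [d] because the recession cone is trivial; the ray stops at the
    first one reached, which was not active at [x]. *)
Lemma ray_exit x d : P x -> d != 0 -> (forall i, i \in act x -> dot (a i) d = 0) ->
  exists t : R, [/\ 0 < t, P (x + t *: d), act x \subset act (x + t *: d)
                 & (#|act x| < #|act (x + t *: d)|)%N].
Proof.
move=> Px d0 dx; have [i0 i0P] := wf.1 _ d0.
pose g i := (b i - dot (a i) x) / dot (a i) d.
pose i1 := [arg min_(i < i0 | 0 < dot (a i) d) g i]%O.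
have [i1P i1min] : 0 < dot (a i1) d /\
    forall i, 0 < dot (a i) d -> g i1 <= g i.
  by rewrite /i1; case: arg_minP.
have i1x : i1 \notin act x by apply/negP => /dx E; rewrite E ltxx in i1P.
have t0 : 0 < g i1 by rewrite divr_gt0 // subr_gt0 active_slack.
have sub : act x \subset act (x + g i1 *: d).
  apply/fintype.subsetP => i ix; apply/activeP.
  by rewrite dotDr dotZr dx // mulr0 addr0 (activeP _ _ _ _ ix).
exists (g i1); split=> //.
  move=> i; rewrite dotDr dotZr; have [dle|dgt] := lerP (dot (a i) d) 0.
    by have := Px i; nra.
  by have := i1min i dgt; rewrite {2}/g ler_pdivlMr //; lra.
apply: proper_card; rewrite properE sub; apply/subsetPn; exists i1 => //.
by apply/activeP; rewrite dotDr dotZr /g divfK ?gt_eqF //; lra.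
Qed.

(* The induction form of "every point is a convex combination of the vertices
   of its carrier face". *)
Lemma vertex_induction (C : set 'rV[R]_n) x :
    (forall y z (t : R), 0 <= t <= 1 -> C y -> C z -> C ((1 - t) *: y + t *: z)) ->
    P x -> (forall v, vertex P v -> act x \subset act v -> C v) ->
  C x.
Proof.
move=> convC; have [m] := ubnP (n - #|act x|).
elim: m x => // m IH x; rewrite ltnS => xm Px Cv.
have := card_active_le Px; rewrite leq_eqVlt => /orP[/eqP xn|xn].
  by apply: Cv => //; apply/vertexP.
(* Both rays along [d] end at points with more active constraints, and [x] lies between these
   ends. *)
have [d d0 dP] := active_kernel_dir Px xn.
have [t [t0 Py xy lty]] := ray_exit Px d0 dP.
have [|i ix|u [u0 Pz xz ltz]] := @ray_exit x (- d) Px.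
- by rewrite oppr_eq0.
- by rewrite dotNr dP ?oppr0.
have Cy : C (x + t *: d).
  apply: IH => // [|v Vv yv]; first by apply: leq_trans (ltn_sub2l _ _) xm.
  by apply: Cv => //; apply: fintype.subset_trans yv.
have Cz : C (x + u *: (- d)).
  apply: IH => // [|v Vv yv]; first by apply: leq_trans (ltn_sub2l _ _) xm.
  by apply: Cv => //; apply: fintype.subset_trans yv.
have tu : t + u != 0 by rewrite gt_eqF ?addr_gt0.
suff -> : x = (1 - t / (t + u)) *: (x + t *: d) + (t / (t + u)) *: (x + u *: - d).
  apply: convC => //; rewrite divr_ge0 ?(ltW t0) ?addr_ge0 ?(ltW u0) ?(ltW t0) //=.
  by rewrite ler_pdivrMr ?addr_gt0 // mul1r lerDl ltW.
apply/matrixP => i j; rewrite !mxE; field; exact: tu.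
Qed.

Lemma vertex_above x : P x -> exists2 v, vertex P v & act x \subset act v.
Proof.
move=> Px; pose C (_ : 'rV[R]_n) := exists2 v, vertex P v & act x \subset act v.
by apply: (@vertex_induction C x) => // v Vv xv; exists v.
Qed.

(** A vertex is determined by its active set, so the subsets of [I] index all vertices. A subset
    without a vertex is sent to an arbitrary point of [P], which does no harm in a convex hull. *)
Lemma finite_vertices : exists m (p : 'I_m -> 'rV[R]_n),
  (forall i, P (p i)) /\ forall v, vertex P v -> exists i, p i = v.
Proof.
have [[x0 Px0]|Pe] := pselect (P !=set0); last first.
  exists 0%N, (fun=> 0); split=> [[]//|v /vertexP[Pv _]].
  by case: Pe; exists v.
pose Q S v := vertex P v /\ act v = S.
exists #|{set I}|, (fun k => xget x0 (Q (enum_val k))); split=> [k|v Vv].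
  by case: xgetP => [y _ [/vertexP[]]|].
exists (enum_rank (act v)); rewrite enum_rankK.
case: xgetP => [x _ [/vertexP[Px xn] E]|/(_ v)[]//].
apply/eqP; rewrite -subr_eq0; apply/eqP.
apply: (card_active_full Px xn) => i ix; rewrite dotBr (activeP _ _ _ _ ix).
by move: ix; rewrite E => /activeP ->; rewrite subrr.
Qed.

Lemma polyhedron_convex_polytope : convex_polytope P.
Proof.
have [m [p [pP pV]]] := finite_vertices.
exists m, p; apply/seteqP; split=> x; last first.
  move=> [w [w0 w1 ->]] i; rewrite dot_sumr -[leRHS]mul1r -w1 mulr_suml.
  by apply: ler_sum => k _; apply: ler_wpM2l => //; apply: pP.
move=> Px; apply: (@vertex_induction _ x) => // [y z t /andP[t0 t1]|v Vv _].
  move=> [w [w0 w1 ->]] [u [u0 u1 ->]].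
  exists (fun i => (1 - t) * w i + t * u i); split=> [i||].
  - by rewrite addr_ge0 ?mulr_ge0 ?subr_ge0.
  - by rewrite big_split /= -!mulr_sumr w1 u1; ring.
  - rewrite !scaler_sumr -big_split; apply: eq_bigr => i _.
    by rewrite /= !scalerA -scalerDl.
have [i <-] := pV v Vv.
exists (fun j => (j == i)%:R); split=> [j||]; first by rewrite ler0n.
  by rewrite (bigD1 i) //= big1 ?eqxx ?addr0 // => j /negbTE ->.
rewrite (bigD1 i) //= big1 ?eqxx ?addr0 ?scale1r // => j /negbTE ->.
by rewrite scale0r.
Qed.

Lemma face_complex0 : P !=set0 -> face_complex a b finset.set0.
Proof.
by move=> [x Px]; apply/active_face_nonempty => //; exists x; split; rewrite ?finset.sub0set.
Qed.

Lemma active_face0 : active_face a b finset.set0 = P.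
Proof. by apply/seteqP; split=> x; [case|split; rewrite ?finset.sub0set]. Qed.

Lemma aff_dim_polyhedron : P !=set0 -> aff_dim P = n.
Proof.
by move=> /face_complex0 K0; rewrite -active_face0 aff_dim_active_face // cards0 subn0.
Qed.

Lemma facets_at v : vertex P v ->
  [set F | facet P F /\ F v] = [set active_face a b [set i]%SET | i in [set` act v]].
Proof.
move=> /vertexP[Pv vn]; have dimP : aff_dim P = n.
  by apply: aff_dim_polyhedron; exists v.
have Kv : face_complex a b (act v) by exists v.
apply/seteqP; split=> [F [[/nonempty_faceP[//|S KS ->]]]|_ [i /= iv <-]].
  rewrite dimP aff_dim_active_face // => Sn [_ Sv].
  have /cards1P[i Si] : #|S| == 1%N.
    (* The bound [#|S| <= n] excludes truncation in the subtraction. *)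
    by case: KS => [x Px xS]; have := card_active_le Px; rewrite /act xS; lia.
  by exists i; rewrite -?Si //=; apply: (fintype.subsetP Sv); rewrite Si finset.set11.
have iv1 : [set i]%SET \subset act v by rewrite finset.sub1set.
have Ki := face_complex_sub wf iv1 Kv.
split; last by split.
split; first exact: active_face_is_face.
rewrite dimP aff_dim_active_face // cards1.
by have := subset_leq_card iv1; rewrite cards1 vn; lia.
Qed.

(** The facets at [v] correspond to the [n] constraints active there, without repetition since a
    face determines its set in the complex. *)
Lemma polyhedron_simple : simple P.
Proof.
move=> v Vv; rewrite facets_at //; have /vertexP[Pv vn] := Vv.
rewrite aff_dim_polyhedron; last by exists v.
have Kv : face_complex a b (act v) by exists v.
pose f (k : 'I_#|act v|) := active_face a b [set enum_val k]%SET.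
have -> : [set active_face a b [set i]%SET | i in [set` act v]] = [set f k | k in [set: _]].
  apply/seteqP; split=> [_ [i /= iv <-]|_ [k _ <-]].
    by exists (enum_rank_in iv i) => //; rewrite /f enum_rankK_in.
  by exists (enum_val k) => //=; apply: enum_valP.
have -> : `I_n = `I_#|act v| by rewrite vn.
apply: card_eq_trans (card_esym card_II); apply: inj_card_eq.
move=> j k _ _ E; apply/enum_val_inj/finset.set1_inj.
apply: (active_face_inj _ _ E); apply: (face_complex_sub wf _ Kv);
  by rewrite finset.sub1set enum_valP.
Qed.

End Dimension.

(** * Truncation of one face *)

Definition update (I : eqType) (A : Type) (f : I -> A) (i0 : I) (y : A) : I -> A :=
  fun i => if i == i0 then y else f i.

Lemma lt_conv (R : realType) (m y z t : R) :
  0 <= t <= 1 -> m < y -> m < z -> m < (1 - t) * y + t * z.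
Proof.
move=> /andP[t0 t1] my mz; have [->|tn] := eqVneq t 0; first lra.
have h1 : 0 < t * (z - m) by rewrite mulr_gt0 ?subr_gt0 // lt_def tn.
have h2 : 0 <= (1 - t) * (y - m) by rewrite mulr_ge0 ?subr_ge0 ?(ltW my).
lra.
Qed.

Section Truncation.
Variables (R : realType) (n : nat) (I : finType) (a : I -> 'rV[R]_n) (b : I -> R).
Hypothesis wf : simple_system a b.
Implicit Types (x y d v : 'rV[R]_n) (S : {set I}).

Let P := polyhedron a b.
Let act := active a b.

Variable S0 : {set I}.

(** The sum of the normals in [S0] is maximal exactly on the face. The finitely many other listed
    points stay below the maximum by a gap [e], and the cut is made halfway into it. *)
Lemma exists_truncation : face_complex a b S0 ->
  exists Q, truncation P (active_face a b S0) Q.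
Proof.
move=> K0.
pose c := \sum_(i in S0) a i; pose be := \sum_(i in S0) b i.
have [m [p [pP pV]]] := finite_vertices wf.
have cle i : dot c (p i) <= be.
  by rewrite dot_suml; apply: ler_sum => j _; apply: pP.
have [e e0 eP] := @finite_lower_bound R 'I_m (fun i => dot c (p i) < be)
  (fun i => be - dot c (p i)) (fun i h => etrans (subr_gt0 _ _) h).
exists (P `&` [set x | dot c x <= be - e / 2]); split.
  exact: active_face_is_face.
exists c, (be - e / 2); split=> // v Vv.
  move=> [Pv Sv].
  have -> : dot c v = be.
    by rewrite dot_suml; apply: eq_bigr => i /(fintype.subsetP Sv)/activeP.
  by lra.
move=> Fv; have [i pi] := pV v Vv.
have : dot c (p i) < be.
  rewrite lt_neqAle cle andbT; apply/eqP => cv; apply: Fv; rewrite -pi; split=> //.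
  apply/fintype.subsetP => j jS; apply: contraT => nj.
  suff : dot c (p i) < be by rewrite cv ltxx.
  rewrite dot_suml /be (bigD1 j) //= [ltRHS](bigD1 j) //=; apply: ltr_leD.
    exact: active_slack.
  by apply: ler_sum => k _; apply: pP.
by move=> /eP; rewrite -pi; lra.
Qed.

(* An index whose constraint [0 <= 1] is void; the cut takes it over. *)
Variable i0 : I.
Hypotheses (ai0 : a i0 = 0) (bi0 : b i0 = 1) (i0S0 : i0 \notin S0).

Variables (c : 'rV[R]_n) (be : R).
Hypothesis c_gt : forall v, vertex P v -> active_face a b S0 v -> be < dot c v.
Hypothesis c_lt : forall v, vertex P v -> ~ active_face a b S0 v -> dot c v < be.

Let a' := update a i0 c.
Let b' := update b i0 be.

Lemma void_inactive x : i0 \notin act x.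
Proof. by rewrite inE ai0 bi0 dot0l eq_sym oner_eq0. Qed.

Lemma polyhedron_update : polyhedron a' b' = P `&` [set x | dot c x <= be].
Proof.
apply/seteqP; split=> x.
  move=> Px; split; last by have := Px i0; rewrite /a' /b' /update eqxx /=.
  move=> i; have := Px i; rewrite /a' /b' /update; case: eqP => // -> _.
  by rewrite ai0 bi0 dot0l.
by move=> [Px cx] i; rewrite /a' /b' /update; case: eqP.
Qed.

Lemma in_active_update x i :
  (i \in active a' b' x) = if i == i0 then dot c x == be else i \in act x.
Proof. by rewrite !inE /a' /b' /update; case: (i =P i0). Qed.

Lemma active_update_lt x : dot c x != be -> active a' b' x = act x.
Proof.
move=> cx; apply/finset.setP => i; rewrite in_active_update.
by case: eqP => // ->; rewrite (negbTE cx) (negbTE (void_inactive x)).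
Qed.

Lemma active_update_eq x : dot c x = be -> active a' b' x :\ i0 = act x.
Proof.
move=> cx; apply/finset.setP => i; rewrite in_setD1 in_active_update.
by case: eqP => // ->; rewrite (negbTE (void_inactive x)).
Qed.

(** Otherwise all vertices of the carrier face of [x] lie in the truncated face, hence beyond the
    cut, and so does [x]. *)
Lemma truncated_off_face x : P x -> dot c x <= be -> ~~ (S0 \subset act x).
Proof.
move=> Px cx; apply/negP => S0x.
suff : be < dot c x by rewrite ltNge cx.
apply: (@vertex_induction _ _ _ a b wf [set y | be < dot c y] x) => //=.
  by move=> y z t t01 hy hz; rewrite dotDr !dotZr; apply: lt_conv.
move=> v Vv xv; apply: c_gt => //; have /vertexP[//|Pv _] := Vv.
by split=> //; apply: fintype.subset_trans xv.
Qed.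

Lemma vertex_below_cut x : P x -> ~~ (S0 \subset act x) ->
  exists v, [/\ vertex P v, act x \subset act v & dot c v < be].
Proof.
move=> Px; apply: contraNP => nv.
suff [] : active_face a b S0 x by [].
apply: (@vertex_induction _ _ _ a b wf _ x) => // [y z t|v Vv xv].
  exact: active_face_conv.
by apply: contra_notP nv => nF; exists v; split=> //; apply: c_lt.
Qed.

Lemma vertex_above_cut x : P x -> be <= dot c x ->
  exists v, [/\ vertex P v, act x \subset act v & active_face a b S0 v].
Proof.
move=> Px cx; apply: contrapT => nv.
suff : dot c x < be by rewrite ltNge cx.
apply: (@vertex_induction _ _ _ a b wf [set y | dot c y < be] x) => //=.
  move=> y z t t01 hy hz; rewrite -ltrN2 dotDr !dotZr opprD -!mulrN.
  by apply: lt_conv; rewrite ?ltrN2.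
move=> v Vv xv; apply: c_lt => // nF; apply: nv; by exists v.
Qed.

Lemma truncation_simple_system : simple_system a' b'.
Proof.
split=> [d d0|x].
  have [i ip] := wf.1 d d0; exists i; rewrite /a' /update.
  by case: eqP ip => // ->; rewrite ai0 dot0l ltxx.
rewrite polyhedron_update => -[Px /= cx] f.
have [d dP] := wf.2 x Px f.
have [cxE|cxN] := eqVneq (dot c x) be; last first.
  exists d => i; rewrite active_update_lt // => ix.
  rewrite /a' /update; case: eqP => [ii|_]; last exact: dP.
  by have := void_inactive x; rewrite -ii ix.
(* Moving towards [v] keeps the old active constraints tight and changes [c], so the slope of the
   cut can be corrected independently. *)
have [v [Vv xv cv]] := vertex_below_cut Px (truncated_off_face Px cx).
have cd : dot c (v - x) != 0 by rewrite dotBr cxE subr_eq0 lt_eqF.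
exists (d + ((f i0 - dot c d) / dot c (v - x)) *: (v - x)) => i.
rewrite in_active_update dotDr dotZr /a' /update; case: eqP => [-> _|_ ix].
  by rewrite divfK //; ring.
rewrite dP // [dot (a i) _]dotBr (activeP _ _ _ _ ix).
by rewrite (activeP _ _ _ _ (fintype.subsetP xv _ ix)) subrr mulr0 addr0.
Qed.

Lemma cut_crossing x u : P x -> P u -> act x \subset act u ->
  (dot c x < be < dot c u) || (dot c u < be < dot c x) ->
  exists y, [/\ P y, act y = act x & dot c y = be].
Proof.
move=> Px Pu xu cxu.
have cN0 : dot c u - dot c x != 0.
  by rewrite subr_eq0; apply/eqP => E; move: cxu; rewrite E; lra.
pose t := (be - dot c x) / (dot c u - dot c x).
have tE : t * (dot c u - dot c x) = be - dot c x by rewrite divfK.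
have t01 : 0 < t < 1.
  by case/orP: cxu => /andP[h1 h2]; apply/andP; split; nra.
exists ((1 - t) *: x + t *: u); split.
- by apply: polyhedron_conv => //; move: t01 => /andP[/ltW -> /ltW ->].
- by rewrite /act active_conv //; apply/finset.setIidPl.
- by rewrite dotDr !dotZr -[RHS](subrK (dot c x)) -tE; ring.
Qed.

(* Stellar subdivision of the face [S0] of the complex, with new vertex [i0]. *)
Lemma truncation_complex S : face_complex a' b' S <->
  ~~ (S0 \subset S) /\ face_complex a b (if i0 \in S then S :\ i0 :|: S0 else S).
Proof.
have subD1 S1 : (S0 \subset S1 :\ i0) = (S0 \subset S1) by rewrite subsetD1 i0S0 andbT.
split=> [[x]|[S0S]].
  rewrite polyhedron_update => -[Px /= cx] <-.
  have nx := truncated_off_face Px cx.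
  have [cxE|cxN] := eqVneq (dot c x) be.
    rewrite -subD1 in_active_update eqxx cxE eqxx active_update_eq //.
    (* A point on the cut has a vertex of the truncated face in its carrier face; [act x] and [S0]
       are both active there. *)
    split=> //; have [|v [/vertexP[//|Pv _] xv [_ Sv]]] := vertex_above_cut Px.
      by rewrite cxE.
    apply: (face_complex_sub wf (S' := act v)); last by exists v.
    by rewrite finset.subUset xv.
  rewrite active_update_lt // (negbTE (void_inactive x)).
  by split=> //; exists x.
have QP x : P x -> dot c x <= be -> polyhedron a' b' x by rewrite polyhedron_update.
case: ifP => iS KS.
  have [x Px xS] : face_complex a b (S :\ i0).
    by apply: (face_complex_sub wf _ KS); apply: finset.subsetUl.
  have nx : ~~ (S0 \subset act x) by rewrite /act xS subD1.
  have [v [/vertexP[//|Pv _] xv cv]] := vertex_below_cut Px nx.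
  have [z Pz zS] := KS.
  have [w Vw zw] := vertex_above wf Pz; have /vertexP[//|Pw _] := Vw.
  rewrite zS finset.subUset -xS in zw; have /andP[xw S0w] := zw.
  have cw : be < dot c w by apply: c_gt.
  (* The carrier face of [x] has [v] below the cut and [w] above it; moving from [x] towards one of
     them meets the cut without changing the active set. *)
  have [y [Py yx cy]] : exists y, [/\ P y, act y = act x & dot c y = be].
    have [cx|cx|cx] := ltrgtP (dot c x) be; last by exists x.
      by apply: (cut_crossing Px Pw xw); apply/orP; left; rewrite cx cw.
    by apply: (cut_crossing Px Pv xv); apply/orP; right; rewrite cx cv.
  exists y; first by apply: QP => //; rewrite cy.
  apply/finset.setP => i; rewrite in_active_update; case: eqP => [->|/eqP ii].
    by rewrite cy eqxx iS.
  by rewrite yx /act xS in_setD1 ii.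
have [x Px xS] := KS.
have [v [/vertexP[//|Pv _] xv cv]] : exists v,
    [/\ vertex P v, act x \subset act v & dot c v < be].
  by apply: vertex_below_cut => //; rewrite /act xS.
(* The weight [t] of [x] is small enough to put the combination with [v] strictly below the cut, yet
   positive, so that the active set remains that of [x]. *)
pose D := `|dot c x - dot c v|; pose e := be - dot c v; pose t := e / (1 + e + D).
have e0 : 0 < e by rewrite subr_gt0.
have D0 : 0 <= D by apply: normr_ge0.
have den0 : 0 < 1 + e + D by lra.
have t01 : 0 < t < 1.
  by rewrite divr_gt0 //= ltr_pdivrMr //; lra.
have tE : t * (1 + e + D) = e by rewrite divfK // gt_eqF.
have cz : dot c ((1 - t) *: v + t *: x) < be.
  rewrite dotDr !dotZr; have := ler_norm (dot c x - dot c v); rewrite -/D.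
  have -> : be = e + dot c v by rewrite /e; ring.
  move/andP: t01 => [t0 t1]; rewrite -[X in _ < X + _]tE; nra.
exists ((1 - t) *: v + t *: x).
  apply: QP; last exact: ltW.
  by apply: polyhedron_conv => //; move: t01 => /andP[/ltW -> /ltW ->].
rewrite active_update_lt ?lt_eqF // /act active_conv // -xS.
exact/finset.setIidPr.
Qed.

End Truncation.

(** * Combinatorics of the iterated subdivision *)

Section CutComplex.
Variable T : finType.
Implicit Types (A B : {set T}) (v : T) (L : seq {set T}).

(* [inl u] is the facet of the design tube [u] in the graph cubeahedron; [inr v]
   is the facet [x_v = 0] of the cube, which survives until [v] is truncated as
   a round tube. *)
Definition constraint : finType := (tube T + T)%type.
Implicit Types S : {set constraint}.

Definition round_constraint A : constraint := inl (inl A).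
Definition square_constraint v : constraint := inl (inr v).
Definition zero_constraint v : constraint := inr v.

Definition zeros A : {set constraint} := [set zero_constraint v | v in A]%SET.

(** Undoing the subdivisions from the last one replaces each cut of a tube by the zero constraints
    of its nodes. When the turn of [B] comes, exactly the cuts after [B] have been replaced. *)
Definition later_cover L S B : {set T} :=
  [set v | (zero_constraint v \in S) ||
     [exists A, [&& round_constraint A \in S, (index B L < index A L)%N & v \in A]]]%SET.

(* The boundary complex after truncating the faces of the tubes in [L], in this
   order. *)
Definition cut_complex L S : Prop :=
  [/\ forall A, round_constraint A \in S -> A \in L,
      forall v, square_constraint v \in S -> zero_constraint v \notin S /\
        forall A, round_constraint A \in S -> v \notin A
    & forall B, B \in L -> ~~ (B \subset later_cover L S B)].

Lemma zeros_subset A S :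
  (zeros A \subset S) = (A \subset [set v | zero_constraint v \in S]%SET).
Proof.
apply/fintype.subsetP/fintype.subsetP => h => [v vA|_ /imsetP[v vA ->]].
  by rewrite inE; apply: h; apply: imset_f.
by have := h v vA; rewrite inE.
Qed.

Lemma mem_zeros A v : (zero_constraint v \in zeros A) = (v \in A).
Proof. by rewrite mem_imset // => ? ? []. Qed.

Lemma round_notin_zeros A B : round_constraint B \notin zeros A.
Proof. by apply/imsetP => -[]. Qed.

Lemma square_notin_zeros A v : square_constraint v \notin zeros A.
Proof. by apply/imsetP => -[]. Qed.

(** The recursion of [truncation_complex], with [zeros A] as subdivided face and the cut of [A] as
    new vertex. The new tube comes after all of [L], so its cut counts as zeros for each of them. *)
Lemma cut_complex_rcons L A S : A \notin L ->
  cut_complex (rcons L A) S <->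
  ~~ (zeros A \subset S) /\
  cut_complex L (if round_constraint A \in S
                 then S :\ round_constraint A :|: zeros A else S).
Proof.
move=> AL; set S' := if _ then _ else _.
have zeroE v : (zero_constraint v \in S') =
    (zero_constraint v \in S) || (round_constraint A \in S) && (v \in A).
  by rewrite /S'; case: ifP; rewrite ?orbF // finset.in_setU in_setD1 mem_zeros.
have roundE B : (round_constraint B \in S') = (round_constraint B \in S) && (B != A).
  rewrite /S'; case: ifP => [_|/negbT nA].
    by rewrite finset.in_setU in_setD1 (negbTE (round_notin_zeros _ _)) orbF andbC.
  by case: eqVneq => [->|]; rewrite ?andbT // (negbTE nA).
have squareE v : (square_constraint v \in S') = (square_constraint v \in S).
  rewrite /S'; case: ifP => // _.
  by rewrite finset.in_setU in_setD1 (negbTE (square_notin_zeros _ _)) orbF.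
have indexA : index A (rcons L A) = size L.
  by rewrite -cats1 index_cat (negbTE AL) /= eqxx addn0.
have coverE B : B \in L -> later_cover (rcons L A) S B = later_cover L S' B.
  move=> BL; apply/finset.setP => v; rewrite !inE zeroE -orbA; congr (_ || _).
  have indexB : index B (rcons L A) = index B L by rewrite -cats1 index_cat BL.
  have ltB : (index B L < size L)%N by rewrite index_mem.
  (* A set outside [L] has an index beyond that of [B] in both lists. *)
  have indexE C : C != A ->
      (index B (rcons L A) < index C (rcons L A))%N = (index B L < index C L)%N.
    move=> CA; rewrite indexB -cats1 index_cat; case: ifP => // /negbT CL.
    by rewrite (memNindex CL) ltB ltn_addr.
  apply/existsP/orP => [[C /and3P[CS lt vC]]|[/andP[AS vA]|/existsP[C]]].
  - have [E|CA] := eqVneq C A; first by left; rewrite -E CS vC.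
    by right; apply/existsP; exists C; rewrite roundE CS CA vC -indexE ?lt.
  - by exists A; rewrite AS vA indexB indexA ltB.
  - rewrite roundE => /and3P[/andP[CS CA] lt vC].
    by exists C; rewrite CS vC indexE ?lt.
split=> [[S1 S2 S3]|[A0 [S1 S2 S3]]].
  split; last first.
    split=> [B|v|B BL].
    - by rewrite roundE => /andP[/S1]; rewrite mem_rcons inE => /predU1P[->|//]; rewrite eqxx.
    - rewrite squareE => /S2[vS vA]; split.
        rewrite zeroE (negbTE vS) /=; apply/andP => -[/vA]; exact/negP.
      by move=> B; rewrite roundE => /andP[/vA].
    - by rewrite -coverE //; apply: S3; rewrite mem_rcons inE BL orbT.
  rewrite zeros_subset; apply: contra (S3 A _); last by rewrite mem_rcons mem_head.
  move=> /fintype.subset_trans; apply; apply/fintype.subsetP => v.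
  by rewrite !inE => ->.
split=> [B BS|v vS|B].
- rewrite mem_rcons inE; have [//|BA] := eqVneq B A.
  by rewrite S1 // roundE BS.
- have [] := S2 v; rewrite ?squareE // zeroE negb_or => /andP[vS0 nA] vA.
  split=> // B BS; have [E|BA] := eqVneq B A; last by apply: vA; rewrite roundE BS.
  by move: nA; rewrite -E BS.
rewrite mem_rcons inE => /predU1P[->|BL]; last by rewrite coverE // S3.
apply: contra A0; rewrite zeros_subset => /fintype.subset_trans; apply.
apply/fintype.subsetP => v; rewrite !inE => /orP[//|/existsP[C /and3P[CS]]].
rewrite indexA; have [->|CA] := eqVneq C A; first by rewrite indexA ltnn.
have CL : C \in L by apply: S1; rewrite roundE CS.
by rewrite -cats1 index_cat CL ltnNge ltnW // index_mem.
Qed.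

(** No cut occurs in [zeros A], so every [later_cover] is just [A]. *)
Lemma cut_complex_zeros L A :
  (forall B, B \in L -> ~~ (B \subset A)) -> cut_complex L (zeros A).
Proof.
move=> LA; split=> [B|v|B BL].
- by rewrite (negbTE (round_notin_zeros _ _)).
- by rewrite (negbTE (square_notin_zeros _ _)).
apply: contra (LA B BL) => /fintype.subset_trans; apply.
apply/fintype.subsetP => v; rewrite inE mem_zeros => /orP[//|/existsP[C /andP[]]].
by rewrite (negbTE (round_notin_zeros _ _)).
Qed.

End CutComplex.

(** * The cube and its successive truncations *)

Section Stages.
Variables (R : realType) (T : finType).
Implicit Types (A B : {set T}) (v : T) (L : seq {set T}) (x d : 'rV[R]_#|T|).
Implicit Types (S : {set constraint T}) (P Q : set 'rV[R]_#|T|).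

(* The cuts not made yet are the void constraints [0 <= 1]. *)
Definition cube_normal (i : constraint T) : 'rV[R]_#|T| :=
  match i with
  | inl (inl _) => 0
  | inl (inr v) => delta_mx 0 (enum_rank v)
  | inr v => - delta_mx 0 (enum_rank v)
  end.

Definition cube_bound (i : constraint T) : R := if i is inl _ then 1 else 0.

Lemma cubeP x : cube x <-> forall v,
  dot (cube_normal (square_constraint v)) x <= cube_bound (square_constraint v) /\
  dot (cube_normal (zero_constraint v)) x <= cube_bound (zero_constraint v).
Proof.
split=> [cx v|h j] /=.
  by rewrite dotNl !dot_deltal oppr_le0; have /andP[] := cx (enum_rank v).
have := h (enum_val j); rewrite /= dotNl !dot_deltal enum_valK oppr_le0 => -[-> ->].
by [].
Qed.

Lemma cube_polyhedron : @cube R T = polyhedron cube_normal cube_bound.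
Proof.
apply/seteqP; split=> x; last by move=> Px; apply/cubeP => v; split; apply: Px.
by move=> /cubeP cx [[A|v]|v]; rewrite /= ?dot0l ?ler01 //; have [] := cx v.
Qed.

Lemma cube_simple_system : simple_system cube_normal cube_bound.
Proof.
split=> [d /rV0Pn[j]|x Px f].
  rewrite neq_lt => /orP[dj|dj].
    by exists (inr (enum_val j)); rewrite /= dotNl dot_deltal enum_valK oppr_gt0.
  by exists (inl (inr (enum_val j))); rewrite /= dot_deltal enum_valK.
(* At most one of the two bounds on a coordinate is tight, so slopes can be prescribed
   coordinatewise. *)
exists (\row_j if x 0 j == 0 then - f (inr (enum_val j)) else f (inl (inr (enum_val j)))).
move=> [[A|v]|v]; rewrite inE /= ?dotNl ?dot0l ?dot_deltal ?mxE ?enum_rankK.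
- by rewrite eq_sym oner_eq0.
- by move=> /eqP ->; rewrite oner_eq0.
- by rewrite oppr_eq0 => ->; rewrite opprK.
Qed.

Lemma cube_complex S : face_complex cube_normal cube_bound S <-> cut_complex [::] S.
Proof.
have half0 : (1 / 2 : R) == 0 = false by apply: gt_eqF; lra.
have half1 : (1 / 2 : R) == 1 = false by apply: lt_eqF; lra.
split=> [[x Px <-]|[S1 S2 _]].
  split=> [A|v|//]; first by rewrite inE /= dot0l eq_sym oner_eq0.
  rewrite !inE /= dotNl dot_deltal => /eqP ->; rewrite oppr_eq0 oner_eq0.
  by split=> // A; rewrite inE /= dot0l eq_sym oner_eq0.
pose x : 'rV[R]_#|T| := \row_j if zero_constraint (enum_val j) \in S then 0
  else if square_constraint (enum_val j) \in S then 1 else 1 / 2.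
exists x.
  rewrite -cube_polyhedron => j; rewrite mxE.
  case: ifP => _; [|case: ifP => _]; rewrite ?lexx ?ler01 //.
  by rewrite divr_ge0 ?ler01 //= ler_pdivrMr // mul1r ler1n.
apply/finset.setP => -[[A|v]|v]; rewrite inE /=.
- rewrite dot0l eq_sym oner_eq0; apply/esym/negbTE/negP => /S1; by [].
- rewrite dot_deltal mxE enum_rankK; case: ifP => [zS|zS].
    by rewrite eq_sym oner_eq0; apply/esym/negbTE/negP => /S2[]; rewrite zS.
  rewrite -[inl (inr v)]/(square_constraint v).
  by case: ifP; rewrite ?eqxx // => _; rewrite half1.
- rewrite dotNl oppr_eq0 dot_deltal mxE enum_rankK -[inr v]/(zero_constraint v).
  case: ifP; rewrite ?eqxx // => _; case: ifP => _; last by rewrite half0.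
  by rewrite oner_eq0.
Qed.

(** The invariant of the iteration. The third clause keeps pending cuts void, ready to be taken
    over, and the cube constraints unchanged, so that [round_face] can still be read off them. *)
Definition stage L P : Prop := exists a b,
  [/\ simple_system a b, P = polyhedron a b,
      forall i : constraint T, (if i is inl (inl A) then A \notin L else true) ->
        a i = cube_normal i /\ b i = cube_bound i
    & forall S, face_complex a b S <-> cut_complex L S].

Lemma stage_cube : stage [::] (@cube R T).
Proof.
exists cube_normal, cube_bound; split=> //.
- exact: cube_simple_system.
- exact: cube_polyhedron.
- exact: cube_complex.
Qed.

Lemma round_faceE A x :
  round_face A x <-> cube x /\ forall v, v \in A -> x 0 (enum_rank v) = 0.
Proof.
split=> [[cx Ax]|[cx Ax]]; split=> // v vA; first by have [_] := Ax v vA.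
by split=> //; apply: Ax.
Qed.

Lemma round_face_active L a b A :
    (forall i : constraint T, (if i is inl (inl A) then A \notin L else true) ->
        a i = cube_normal i /\ b i = cube_bound i) ->
  round_face A `&` polyhedron a b = active_face a b (zeros A).
Proof.
move=> abE; apply/seteqP; split=> x.
  move=> [/round_faceE[_ Ax] Px]; split=> //.
  apply/fintype.subsetP => _ /imsetP[v vA ->]; apply/activeP.
  have [-> ->] := abE (zero_constraint v) isT.
  by rewrite /= dotNl dot_deltal Ax // oppr0.
move=> [Px Ax]; split=> //; apply/round_faceE; split.
  apply/cubeP => v.
  have [<- <-] := abE (zero_constraint v) isT.
  by have [<- <-] := abE (square_constraint v) isT.
move=> v vA; have : zero_constraint v \in active a b x.
  by apply: (fintype.subsetP Ax); apply: imset_f.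
move=> /activeP; have [-> ->] := abE (zero_constraint v) isT.
by rewrite /= dotNl dot_deltal => /eqP; rewrite oppr_eq0 => /eqP.
Qed.

Lemma stage_truncation L P A Q : A \notin L -> stage L P ->
  truncation P (round_face A `&` P) Q -> stage (rcons L A) Q.
Proof.
move=> AL [a [b [wf -> abE KE]]]; rewrite (round_face_active _ abE).
move=> [_ [c [be [cgt clt ->]]]].
have [a0 b0] := abE (round_constraint A) AL.
exists (update a (round_constraint A) c), (update b (round_constraint A) be).
have rz := round_notin_zeros A A.
split; [|by rewrite (polyhedron_update a0 b0)| |].
  exact: (truncation_simple_system wf a0 b0 cgt clt).
  move=> i iL; rewrite /update; case: eqP => [E|/eqP iA].
    by move: iL; rewrite E /= mem_rcons mem_head.
  apply: abE; move: i iL iA => [[B|//]|//].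
  by rewrite mem_rcons inE negb_or => /andP[].
move=> S; rewrite cut_complex_rcons //.
by rewrite -KE; apply: (truncation_complex wf a0 b0 rz cgt clt).
Qed.

Lemma stage_truncations L L' P Q : uniq (L ++ L') -> stage L P ->
  truncations P [seq round_face A | A <- L'] Q -> stage (L ++ L') Q.
Proof.
elim: L' L P => [|A L' IH] L P /=; first by rewrite cats0 => _ ? ->.
rewrite -cat_rcons => LL' sP [P' [tP]]; apply: IH => //.
apply: stage_truncation tP => //.
by move: LL'; rewrite cat_uniq rcons_uniq -andbA => /andP[].
Qed.

(** As no earlier tube is contained in a later one, what is left of each face is nonempty when its
    turn comes. *)
Lemma exists_truncations L L' P :
  uniq (L ++ L') -> pairwise (fun B A => ~~ (B \subset A)) (L ++ L') ->
  stage L P -> exists Q, truncations P [seq round_face A | A <- L'] Q.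
Proof.
elim: L' L P => [|A L' IH] L P /=; first by exists P.
rewrite -cat_rcons => LL' pL sP.
have [Q tQ] : exists Q, truncation P (round_face A `&` P) Q.
  have [a [b [wf -> abE KE]]] := sP; rewrite (round_face_active _ abE).
  apply: exists_truncation => //; apply/KE/cut_complex_zeros => B BL.
  move: pL; rewrite pairwise_cat pairwise_rcons => /and3P[_ /andP[/allP h _] _].
  exact: h.
have /(IH _ _ LL' pL)[Q' tQ'] : stage (rcons L A) Q; last by exists Q', Q.
apply: stage_truncation tQ => //.
by move: LL'; rewrite cat_uniq rcons_uniq -andbA => /andP[].
Qed.

(** Turns increasing dimension of faces into decreasing size of tubes. *)
Lemma aff_dim_round_face A : aff_dim (@round_face R T A) = (#|T| - #|A|)%N.
Proof.
have E : @round_face R T A = active_face cube_normal cube_bound (zeros A).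
  rewrite -(@round_face_active [::]) // -cube_polyhedron.
  by apply/esym/setIidPl => x /round_faceE[].
rewrite E aff_dim_active_face ?card_imset // => [? ? []//||].
- exact: cube_simple_system.
- exact/cube_complex/cut_complex_zeros.
Qed.

End Stages.

(** * Design tubings and the cut complex *)

Section Tubings.
Variables (T : finType) (e : rel T).
Hypothesis e_sym : symmetric e.
Implicit Types (A B C : {set T}) (u w : tube T) (S : {set constraint T}).

(** The last hypothesis treats a common node and a joining edge alike, hence both intersecting and
    adjacent tubes. *)
Lemma connected_inU A B x y : connected_in e A -> connected_in e B ->
  x \in A -> y \in B -> (x == y) || e x y -> connected_in e (A :|: B).
Proof.
move=> cA cB xA yB xy.
pose r C := [rel p q | [&& p \in C, q \in C & e p q]].
have conn C p q : connected_in e C -> C \subset A :|: B -> p \in C -> q \in C ->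
    connect (r (A :|: B)) p q.
  move=> /forall_inP cC CAB pC qC; have /forall_inP/(_ _ qC) := cC _ pC.
  apply: connect_sub => i j /= /and3P[iC jC ij]; apply: connect1.
  by rewrite /= !(fintype.subsetP CAB) ?ij.
have sA : A \subset A :|: B by apply: finset.subsetUl.
have sB : B \subset A :|: B by apply: finset.subsetUr.
have xy' : connect (r (A :|: B)) x y /\ connect (r (A :|: B)) y x.
  case/orP: xy => [/eqP <-|xy]; first by split; apply: connect0.
  by split; apply: connect1; rewrite /= !finset.in_setU xA yB ?(e_sym y) xy ?orbT.
apply/forall_inP => p pAB; apply/forall_inP => q qAB.
move: pAB qAB; rewrite !finset.in_setU => /orP[pA|pB] /orP[qA|qB].
- exact: conn cA _ _ _.
- exact: connect_trans (conn _ _ _ cA sA pA xA) (connect_trans xy'.1 (conn _ _ _ cB sB yB qB)).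
- exact: connect_trans (conn _ _ _ cB sB pB yB) (connect_trans xy'.2 (conn _ _ _ cA sA xA qA)).
- exact: conn cB _ _ _.
Qed.

Lemma connected_in_exit A B x y : connected_in e B ->
  x \in A -> x \in B -> y \in B -> y \notin A ->
  exists p q, [/\ p \in A, q \in B, q \notin A & e p q].
Proof.
move=> /forall_inP cB xA xB yB yA.
have /forall_inP/(_ y yB)/connectP[s] := cB x xB.
elim: s x xA {xB} => [|z s IH] x xA /=; first by move=> _ E; rewrite E xA in yA.
move=> /andP[/and3P[xB zB xz] zs] yE.
have [zA|zA] := boolP (z \in A); first exact: IH zA zs yE.
by exists x, z.
Qed.

Section Order.
Variable s : seq {set T}.
Hypothesis sE : s =i [pred A | round_tube e A].
Hypothesis s_sorted : forall A B, A \in s -> B \in s ->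
  (index A s < index B s)%N -> (#|B| <= #|A|)%N.

Lemma proper_index A B : A \in s -> B \in s -> A \proper B ->
  (index B s < index A s)%N.
Proof.
move=> As Bs AB; have := proper_card AB; apply: contraTltn.
rewrite -leqNgt leq_eqVlt => /orP[/eqP E|]; last exact: s_sorted.
by move/index_inj: E AB => -> //; rewrite properxx.
Qed.

Lemma cut_complex_compatible S A B : cut_complex s S ->
  round_constraint A \in S -> round_constraint B \in S -> A != B ->
  ~~ adjacent e A B && ~~ intersecting A B.
Proof.
move=> [S1 _ S3] AS BS AB.
have [As Bs] := (S1 _ AS, S1 _ BS).
have [tA tB] : round_tube e A /\ round_tube e B by move: As Bs; rewrite !sE.
have [/andP[A0 cA] /andP[B0 cB]] := (tA, tB).
have nested_or : connected_in e (A :|: B) -> (A \subset B) || (B \subset A).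
  move=> cAB; apply: contraT; rewrite negb_or => /andP[nAB nBA].
  have Cs : A :|: B \in s.
    by rewrite sE inE /round_tube cAB andbT finset.setU_eq0 negb_and A0.
  have /negP[] := S3 _ Cs; apply/fintype.subsetP => v; rewrite !inE => vAB.
  apply/orP; right; apply/existsP; case/orP: vAB => [vA|vB].
    exists A; rewrite AS vA andbT; apply: proper_index => //.
    by rewrite properE finset.subsetUl finset.subUset negb_and nBA orbT.
  exists B; rewrite BS vB andbT; apply: proper_index => //.
  by rewrite properE finset.subsetUr finset.subUset negb_and nAB.
(* Adjacent sets are disjoint, so if nested one of them would be empty. *)
apply/andP; split.
  apply/negP => /andP[/eqP AB0 /nested_or/orP[] h].
    by move: A0; rewrite -AB0 (finset.setIidPl h) eqxx.
  by move: B0; rewrite -AB0 (finset.setIidPr h) eqxx.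
apply/negP => /and3P[/set0Pn[x]]; rewrite inE => /andP[xA xB] nAB nBA.
have := nested_or (connected_inU cA cB xA xB _).
by rewrite eqxx (negbTE nAB) (negbTE nBA) => /(_ isT).
Qed.

Lemma mem_inl_imset (U : {set tube T}) u :
  ((inl u : constraint T) \in [set inl w | w in U]%SET) = (u \in U).
Proof. by rewrite mem_imset // => ? ? []. Qed.

Lemma cut_complex_tubing S : cut_complex s S ->
  exists2 U, design_tubing e U & S = [set inl u | u in U]%SET.
Proof.
move=> KS; have [S1 S2 S3] := KS.
pose U : {set tube T} := [set u | (inl u : constraint T) \in S]%SET.
exists U; last first.
  apply/finset.setP => -[u|v]; first by rewrite mem_inl_imset inE.
  (* A zero constraint at [v] would by itself cover the tube consisting of [v]. *)
  transitivity false; last by apply/esym/imsetP => -[].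
  have vs : [set v]%SET \in s.
    rewrite sE inE /round_tube -card_gt0 cards1 /=.
    by apply/forall_inP => x /set1P->; apply/forall_inP => y /set1P->; apply: connect0.
  by apply: contraNF (S3 _ vs) => vS; rewrite finset.sub1set inE vS.
have sqr_round v A : inl (inr v) \in S -> inl (inl A) \in S -> ~~ nested [set v]%SET A.
  move=> vS AS; have [_ /(_ A AS) vA] := S2 v vS.
  rewrite /nested finset.sub1set negb_or vA; apply: contra vA => /fintype.subsetP sA.
  have : A \in s by apply: S1.
  by rewrite sE => /andP[/set0Pn[x xA] _]; have /sA/set1P <- := xA.
apply/andP; split; apply/forall_inP => u.
  by case: u => [A|//]; rewrite inE => /S1; rewrite sE.
rewrite inE => uS; apply/forall_inP => w; rewrite inE => wS; apply/implyP => uw.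
case: u w uS wS uw => [A|v] [B|x] uS wS uw; rewrite /compatible /=.
- by apply: cut_complex_compatible uS wS _; rewrite ?KS.
- by rewrite /nested orbC; apply: sqr_round.
- exact: sqr_round.
- rewrite /nested !finset.sub1set !inE negb_or (eq_sym x) andbb.
  by apply: contra uw => /eqP ->.
Qed.

Lemma tubing_cut_complex (U : {set tube T}) : design_tubing e U ->
  cut_complex s [set inl u | u in U]%SET.
Proof.
move=> /andP[/forall_inP tU /forall_inP cU]; split=> [A|v|B Bs].
- by rewrite mem_inl_imset sE => /tU.
- rewrite mem_inl_imset => vU; split; first by apply/imsetP => -[].
  move=> A; rewrite mem_inl_imset => AU.
  have /forall_inP/(_ _ AU) := cU _ vU.
  by rewrite /compatible /= /nested finset.sub1set negb_or => /andP[].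
apply/negP => Bcov.
pose p A := [&& (inl A : tube T) \in U, (index B s < index A s)%N & A :&: B != finset.set0].
have cover v : v \in B -> exists2 A, p A & v \in A.
  move=> vB; have := fintype.subsetP Bcov v vB; rewrite inE => /orP[/imsetP[]//|].
  move=> /existsP[A]; rewrite mem_inl_imset => /and3P[AU lt vA].
  by exists A; rewrite // /p AU lt; apply/set0Pn; exists v; rewrite inE vA.
have := Bs; rewrite sE => /andP[/set0Pn[x0 /cover[A0 pA0 _]] cB].
(* Among the tubes of [U] that come after [B] and meet it, take a largest one; coming after [B], it
   cannot contain [B]. *)
have [A /and3P[AU lt AB] Amax] := @arg_maxnP _ A0 p (fun A => #|A|) pA0.
have /andP[_ cA] := tU _ AU.
have As : A \in s by rewrite sE; apply: tU AU.
have nBA : ~~ (B \subset A).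
  apply/negP => BA; have E : B == A by rewrite finset.eqEcard BA s_sorted.
  by rewrite (eqP E) ltnn in lt.
have [x] := set0Pn _ AB; rewrite inE => /andP[xA xB].
have [y yB yA] := subsetPn nBA.
(* An edge leaves [A] inside [B], and its end [b] lies in another covering tube [A']. Then
   [A :|: A'] is connected, so compatibility forces nesting, and [A'] would be larger than [A]. *)
have [a [b [aA bB bA ab]]] := connected_in_exit cB xA xB yB yA.
have [A' pA' bA'] := cover b bB; have /and3P[AU' _ _] := pA'.
have AA' : inl A != inl A' :> tube T.
  by apply: contra bA => /eqP[->].
have /forall_inP/(_ _ AU')/implyP/(_ AA') := cU _ AU; rewrite /compatible /=.
have /andP[_ cA'] := tU _ AU'.
rewrite /adjacent (connected_inU cA cA' aA bA') ?ab ?orbT // andbT.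
move=> /andP[AA0]; rewrite /intersecting AA0 /= -negb_or negbK => /orP[h|h].
  have : A \proper A' by apply/properP; split=> //; exists b.
  by move=> /proper_card; rewrite ltnNge => /negP; apply; apply: Amax.
by move: bA; rewrite (fintype.subsetP h).
Qed.

End Order.
End Tubings.

(** * Existence and face poset of the graph cubeahedron *)

Section Main.
Variables (R : realType) (T : finType) (e : rel T).
Hypothesis e_sym : symmetric e.

Lemma graph_cubeahedron_exists : exists P : set 'rV[R]_#|T|, graph_cubeahedron e P.
Proof.
pose leT A B := (aff_dim (@round_face R T A) <= aff_dim (@round_face R T B))%N.
pose s := sort leT (enum [pred A | round_tube e A]).
have s_uniq : uniq s by rewrite sort_uniq enum_uniq.
have s_sorted : sorted leT s by apply: sort_sorted => A B; apply: leq_total.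
have [|P sP] := @exists_truncations R T [::] s (@cube R T) s_uniq _ (stage_cube R T).
  have le_trans : transitive leT by move=> ? ? ?; apply: leq_trans.
  (* In a duplicate-free list of decreasing sizes, no earlier tube can lie in a later one. *)
  have : pairwise [rel A B | leT A B && (A != B)] s.
    by rewrite pairwise_relI -sorted_pairwise // s_sorted -uniq_pairwise.
  apply: sub_pairwise => A B /andP[]; rewrite /leT !aff_dim_round_face => AB.
  apply: contra => sAB; rewrite finset.eqEcard sAB.
  by rewrite leq_sub2lE ?max_card in AB.
by exists P, s; split=> // A; rewrite mem_sort mem_enum.
Qed.

(** The order among tubes of equal size and the cutting hyperplanes leave no trace in the
    complex. *)
Lemma graph_cubeahedron_system (P : set 'rV[R]_#|T|) : graph_cubeahedron e P ->
  exists (a : constraint T -> 'rV[R]_#|T|) b,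
    [/\ simple_system a b, P = polyhedron a b
      & forall S, face_complex a b S <->
          exists2 U, design_tubing e U & S = [set inl u | u in U]%SET].
Proof.
move=> [s [s_uniq sE s_sorted tP]].
have [a [b [wf PE _ KE]]] := @stage_truncations _ _ [::] _ _ _ s_uniq (stage_cube R T) tP.
exists a, b; split=> // S; rewrite KE.
have le_trans : transitive (fun A B : {set T} =>
    aff_dim (@round_face R T A) <= aff_dim (@round_face R T B))%N.
  by move=> ? ? ?; apply: leq_trans.
have card_sorted A B : A \in s -> B \in s -> (index A s < index B s)%N -> (#|B| <= #|A|)%N.
  move=> As Bs /(sorted_ltn_index le_trans s_sorted _ _ As Bs).
  by rewrite !aff_dim_round_face leq_sub2lE ?max_card.
split=> [|[U tU ->]]; first exact: cut_complex_tubing.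
exact: tubing_cut_complex.
Qed.

End Main.

Theorem theorem12 (R : realType) (T : finType) (e : rel T) (n : nat)
    (e_sym : symmetric e) (e_irr : irreflexive e)
    (G_conn : connected_in e [set: T]%SET) (card_G : #|T| = n) :
  (exists P : set 'rV[R]_#|T|, graph_cubeahedron e P) /\
  (forall P : set 'rV[R]_#|T|, graph_cubeahedron e P ->
     [/\ convex_polytope P, simple P, aff_dim P = n
       & order_isomorphic
           [set F | nonempty_face P F] (fun F F' => F `<=` F')
           [set U | design_tubing e U] (fun U U' => U' \subset U)]).
Proof.
split=> [|P]; first exact: graph_cubeahedron_exists.
move=> /(graph_cubeahedron_system e_sym)[a [b [wf -> KE]]].
have Ktube U : design_tubing e U -> face_complex a b [set inl u | u in U]%SET.
  by move=> tU; apply/KE; exists U.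
have Pne : polyhedron a b !=set0.
  have [|x Px _] := Ktube finset.set0; last by exists x.
  by apply/andP; split; apply/forall_inP => u; rewrite finset.in_set0.
split.
- exact: polyhedron_convex_polytope.
- exact: polyhedron_simple.
- by rewrite aff_dim_polyhedron.
(* The isomorphism is obtained from its inverse [g], which reverses inclusion. *)
pose g (U : {set tube T}) := active_face a b [set inl u | u in U]%SET.
have g_le (U U' : {set tube T}) : design_tubing e U -> (g U `<=` g U') <-> (U' \subset U).
  move=> tU; rewrite active_face_subset; last exact: Ktube.
  split=> h; last exact: imsetS.
  by apply/fintype.subsetP => u uU'; rewrite -mem_inl_imset (fintype.subsetP h) ?mem_inl_imset.
have g_inj U U' : design_tubing e U -> design_tubing e U' -> g U = g U' -> U = U'.
  move=> tU tU' E; apply/eqP; rewrite finset.eqEsubset.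
  by apply/andP; split; apply/g_le => //; rewrite E.
(* The empty tubing is only a default value for sets that are not faces. *)
pose f F := xget (finset.set0 : {set tube T}) [set U | design_tubing e U /\ F = g U].
have fP F : nonempty_face (polyhedron a b) F -> design_tubing e (f F) /\ F = g (f F).
  move=> /(nonempty_faceP wf)[_ /KE[U tU ->] FE].
  by rewrite /f; case: xgetP => [V _ []//|/(_ U)[]].
exists f; split; first split.
- by move=> F /fP[].
- move=> F F' /set_mem/fP[_ FE] /set_mem/fP[_ FE'] E.
  by rewrite FE FE' E.
- move=> U tU; have gU : nonempty_face (polyhedron a b) (g U).
    by apply: active_face_is_face; [|apply: Ktube].
  by exists (g U) => //; have [tf E] := fP _ gU; apply: g_inj.
- move=> F F' /fP[tF FE] /fP[tF' FE'].
  by rewrite {1}FE {1}FE'; apply: g_le.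
Qed.
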